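(* For every integer $\ell\ge 1$, $$R_{\ell,1}=D_\ell=T_\ell=\begin{cases}\binom{\ell}{2}+\ell & \text{if } \ell \text{ is odd},\\[2pt] \binom{\ell}{2}+\frac{\ell}{2}+1 & \text{if } \ell\text{ is even},\end{cases}$$ where $R_{\ell,1}$ is the sum of the right lane lengths over all arrival sequences of length $\ell$ with exactly one zero, $D_\ell$ is the length of the longest domino snake using a full set of dominoes up to $[\ell:\ell]$, and $T_\ell$ is the number of edges in a longest trail in the complete graph on $\ell$ vertices with loops.
   Context: An arrival sequence of length $\ell$ is a binary string $\mathbf{b}=b_1b_2\cdots b_\ell\in\{0,1\}^\ell$; $B_{\ell,1}$ is the set of those with exactly one zero. Cars $1,2,\dots,\ell$ arrive in order and choose between two initially empty lanes (left and right): if $b_i=0$, car $i$ enters the right lane; if $b_i=1$, car $i$ enters the currently shorter lane, and enters the right lane if both lanes have the same length. $r(\mathbf{b})$ denotes the final number of cars in the right lane, and $R_{\ell,1}=\sum_{\mathbf{b}\in B_{\ell,1}} r(\mathbf{b})$. The full set of dominoes up to $[\ell:\ell]$ consists of one domino $[i:j]$ for each unordered pair (with repetition) $1\le i\le j\le \ell$; a domino may be turned around. A domino snake is a single line of distinct dominoes from this set laid out so that touching ends of consecutive dominoes show the same number; its length is the number of dominoes. $K_\ell^\circ$ is the complete graph on vertices $\{1,\dots,\ell\}$ with one loop added at every vertex. A trail is a walk with no repeated edges (loops count as edges); $T_\ell$ is the maximum number of edges of a trail in $K_\ell^\circ$. *)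

(* Defs.v *)
From mathcomp Require Import all_boot.

Set Implicit Arguments.
Unset Strict Implicit.
Unset Printing Implicit Defensive.

(* The digits 0 and 1 are the booleans [false] and [true]. *)
Definition arrivals (l k : nat) : {set l.-tuple bool} :=
  [set b : l.-tuple bool | count_mem false b == k].

(* A state is the pair (cars in the left lane, cars in the right lane). *)
Definition park (lanes : nat * nat) (b : bool) : nat * nat :=
  let: (l, r) := lanes in
  if b && (l < r) then (l.+1, r) else (l, r.+1).

Definition right_lane (b : seq bool) : nat := (foldl park (0, 0) b).2.

Definition right_total (l k : nat) : nat :=
  \sum_(b in arrivals l k) right_lane b.

(* The numbers 1, ..., l are represented by the ordinals 0, ..., l - 1 of
   ['I_l], here and for the vertices of the graph below. *)
Definition domino (l : nat) := {p : 'I_l * 'I_l | p.1 <= p.2}.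

(* A placed domino carries a flag telling whether it has been turned around. *)
Definition placed (l : nat) := (domino l * bool)%type.

Definition left_end l (d : placed l) : 'I_l :=
  if d.2 then (val d.1).2 else (val d.1).1.

Definition right_end l (d : placed l) : 'I_l :=
  if d.2 then (val d.1).1 else (val d.1).2.

Definition snake l (s : seq (placed l)) : bool :=
  sorted (fun d d' => right_end d == left_end d') s
  && uniq [seq d.1 | d <- s].

(* The bound on n excludes no snake: see [snake_size_le]. *)
Definition longest_snake (l : nat) : nat :=
  \max_(n < #|{: domino l}|.+1 | [exists s : n.-tuple (placed l), snake s]) n.

Lemma snake_size_le l (s : seq (placed l)) :
  snake s -> size s <= longest_snake l.
Proof.
move=> sn_s; have /andP[_ /card_uniqP us] := sn_s.
have lt_s : size s < #|{: domino l}|.+1 by rewrite ltnS -(size_map fst) -us max_card.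
apply: (leq_bigmax_cond (Ordinal lt_s)).
by apply/existsP; exists (in_tuple s).
Qed.

Lemma longest_snake_ex l :
  exists2 s : seq (placed l), snake s & size s = longest_snake l.
Proof.
set P := fun n : 'I_#|{: domino l}|.+1 => [exists s : n.-tuple (placed l), snake s].
have P_gt0 : 0 < #|P|.
  by apply/card_gt0P; exists ord0; apply/existsP; exists (nil_tuple _).
have [n /existsP[s sn_s] max_n] := eq_bigmax_cond (@nat_of_ord _) P_gt0.
by exists s => //; rewrite size_tuple; exact: esym max_n.
Qed.

(* A graph without multiple edges is given by its (symmetric) adjacency relation [e]; its
   edges are the sets [[set u; v]] with [e u v], a loop at [u] being [[set u]].
   A walk is then determined by its first vertex [x] and the sequence [p] of
   its subsequent vertices, so that it has [size p] edges. *)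
Definition walk_edges (V : finType) (x : V) (p : seq V) : seq {set V} :=
  pairmap (fun u v => [set u; v]) x p.

Definition trail (V : finType) (e : rel V) (x : V) (p : seq V) : bool :=
  path e x p && uniq (walk_edges x p).

(* The bound on n excludes no trail: see [trail_size_le]. *)
Definition longest_trail (V : finType) (e : rel V) : nat :=
  \max_(n < #|{set V}|.+1 | [exists x, exists p : n.-tuple V, trail e x p]) n.

Lemma trail_size_le (V : finType) (e : rel V) x p :
  trail e x p -> size p <= longest_trail e.
Proof.
move=> tr_p; have /andP[_ /card_uniqP up] := tr_p.
have lt_p : size p < #|{set V}|.+1.
  by rewrite ltnS -(size_pairmap (fun u v : V => [set u; v]) x) -up max_card.
apply: (leq_bigmax_cond (Ordinal lt_p)).
by apply/existsP; exists x; apply/existsP; exists (in_tuple p).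
Qed.

Lemma longest_trail_ex (V : finType) (e : rel V) (x0 : V) :
  exists x p, trail e x p /\ size p = longest_trail e.
Proof.
set P := fun n : 'I_#|{set V}|.+1 =>
  [exists x, exists p : n.-tuple V, trail e x p].
have P_gt0 : 0 < #|P|.
  apply/card_gt0P; exists ord0; apply/existsP; exists x0.
  by apply/existsP; exists (nil_tuple _).
have [n /existsP[x /existsP[p tr_p]] max_n] :=
  eq_bigmax_cond (@nat_of_ord _) P_gt0.
by exists x, p; split=> //; rewrite size_tuple; exact: esym max_n.
Qed.

Definition complete_graph (l : nat) : rel 'I_l := [rel u v | u != v].
Arguments complete_graph l : clear implicits.

Definition add_loops (V : finType) (e : rel V) : rel V :=
  [rel u v | (u == v) || e u v].

(* Main.v *)
(** In a trail, all but at most two vertices have even degree; for even [l] each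
    of the others is thus incident to at most [l - 2] edges other than loops, and
    summing the degrees gives the upper bound.  It is attained by induction in
    steps of two: if [a] and [b] are two new vertices, the closed walk
    [0 a a 1 b 2 a 3 b ... b b 0] through the old vertices uses all the new edges,
    except [ab] when [l] is even, and can be put in front of an optimal trail
    from [0].  A snake is a trail whose edges are the dominoes.  Finally, if the
    zero is in position [i], the right lane ends up with [uphalf l] cars, except
    with one more when [l] is even and the zero comes last. *)

Require Import Defs.
From mathcomp Require Import all_boot.
From mathcomp Require Import zify.

Set Implicit Arguments.
Unset Strict Implicit.
Unset Printing Implicit Defensive.

(** * Distinctness of images and of edge lists *)

Lemma eq_uniq_map (T : Type) (A B : eqType) (f : T -> A) (g : T -> B) s :
  (forall x y, (f x == f y) = (g x == g y)) ->
  uniq (map f s) = uniq (map g s).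
Proof.
move=> fg; elim: s => //= x s ->; congr (~~ _ && _).
by elim: s => //= y s IHs; rewrite !inE fg IHs.
Qed.

Lemma pairmapE (T A : Type) (f : T -> T -> A) x p :
  pairmap f x p = [seq f e.1 e.2 | e <- pairmap pair x p].
Proof. by elim: p x => //= y p IHp x; rewrite IHp. Qed.

Lemma pairmap_map (S T A : Type) (h : S -> T) (f : T -> T -> A) x p :
  pairmap f (h x) (map h p) = pairmap (fun u v => f (h u) (h v)) x p.
Proof. by elim: p x => //= y p IHp x; rewrite IHp. Qed.

Lemma eq_uniq_pairmap (T : Type) (A B : eqType) (f : T -> T -> A)
    (g : T -> T -> B) x p :
  (forall u v u' v', (f u v == f u' v') = (g u v == g u' v')) ->
  uniq (pairmap f x p) = uniq (pairmap g x p).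
Proof. by move=> fg; rewrite (pairmapE f) (pairmapE g); apply: eq_uniq_map. Qed.

(** * Arithmetic of the claimed value *)

Lemma double_bin2 n : 2 * 'C(n, 2) = n * n.-1.
Proof.
rewrite bin2 mul2n halfK; case: n => //= n.
by rewrite oddM /= andNb subn0.
Qed.

Definition max_size n :=
  if odd n then 'C(n, 2) + n else 'C(n, 2) + n %/ 2 + 1.

(** One formula without binomials for both parities, in the shape in which the right lanes sum up:
    [uphalf n] cars for each of the [n] positions of the zero, and one extra car for even [n]. *)
Lemma max_sizeE n : 0 < n -> max_size n = n * uphalf n + ~~ odd n.
Proof.
move=> n_gt0; have := double_bin2 n; rewrite /max_size uphalf_half.
rewrite divn2; have := odd_double_half n; case: (odd n) => /=; nia.
Qed.

(** * The upper bound on trails *)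

Section TrailBound.
Variable V : finType.
Implicit Types (x v : V) (p : seq V) (E : seq {set V}).

(** The test [#|e| == 2] leaves out the loops, which are singletons. *)
Definition degree E v := count (fun e : {set V} => (v \in e) && (#|e| == 2)) E.

(** Loops aside, each inner visit enters and leaves [v], so only the two ends of the walk affect the
    parity; they cancel in a closed walk. *)
Lemma odd_degree_walk x p v :
  odd (degree (walk_edges x p) v) = (v == x) (+) (v == last x p).
Proof.
elim: p x => [|y p IHp] x /=; first by rewrite addbb.
rewrite oddD IHp cards2 !inE oddb.
have [->|nxy] := eqVneq x y; first by rewrite andbF.
by rewrite andbT; have [->|_] := eqVneq v x; rewrite ?(negbTE nxy) //= addKb.
Qed.

(** Handshake count: an edge other than a loop has two ends. *)
Lemma sum_degree E : \sum_v degree E v = 2 * count (fun e : {set V} => #|e| == 2) E.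
Proof.
elim: E => [|e E IHE]; first by rewrite big1.
rewrite /degree /= big_split /= IHE mulnDr; congr (_ + _).
have [e2|_] := eqVneq #|e| 2; last by rewrite big1 // => v _; rewrite andbF.
rewrite -[RHS]e2 -sum1_card [RHS]big_mkcond /=.
by apply: eq_bigr => v _; rewrite andbT; case: (v \in e).
Qed.

(** Among distinct edges, one at [v] that is not a loop is determined by its other end. *)
Lemma degree_le E v : uniq E -> degree E v <= #|V|.-1.
Proof.
move=> uE; rewrite /degree -size_filter.
have /card_uniqP <- := filter_uniq (fun e : {set V} => (v \in e) && (#|e| == 2)) uE.
rewrite -(cardsC1 v); apply: leq_trans (leq_imset_card (fun u => [set v; u]) _).
apply/subset_leq_card/subsetP=> e; rewrite mem_filter => /andP[/andP[v_e]].
move=> /cards2P[a [b [nab def_e]]] _; move: v_e; rewrite {e}def_e !inE.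
case/orP=> /eqP->; apply/imsetP; first by exists b; rewrite // !inE eq_sym.
by exists a; rewrite ?inE // setUC.
Qed.

Lemma count_loops E : uniq E -> count (fun e : {set V} => #|e| == 1) E <= #|V|.
Proof.
move=> uE; rewrite -size_filter.
have /card_uniqP <- := filter_uniq (fun e : {set V} => #|e| == 1) uE.
apply: leq_trans (leq_imset_card (fun u : V => [set u]) _).
apply/subset_leq_card/subsetP=> e; rewrite mem_filter => /andP[/cards1P[u ->] _].
exact: imset_f.
Qed.

Lemma size_walk_edges x p : size p = count (fun e : {set V} => #|e| == 1) (walk_edges x p)
                                   + count (fun e : {set V} => #|e| == 2) (walk_edges x p).
Proof.
elim: p x => //= y p IHp x; rewrite (IHp y) cards2; case: (x != y) => /=; lia.
Qed.

Lemma trail_size_max x p :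
  uniq (walk_edges x p) -> size p <= max_size #|V|.
Proof.
move=> uE; have V_gt0 : 0 < #|V| by apply/card_gt0P; exists x.
rewrite max_sizeE // (size_walk_edges x).
have sum_const c : \sum_(v : V) c = #|V| * c by rewrite sum_nat_const.
have := count_loops uE; have := sum_degree (walk_edges x p).
set c1 := count _ _; set c2 := count _ _ => sum_deg le_c1.
have [oV|eV] := boolP (odd #|V|).
  have : \sum_v degree (walk_edges x p) v <= \sum_(v : V) #|V|.-1.
    by apply: leq_sum => v _; apply: degree_le.
  rewrite sum_deg sum_const uphalf_half.
  by move: (#|V|) (odd_double_half #|V|) oV le_c1 => n; case: (odd n) => //=; nia.
(* Here [#|V|.-1] is odd, so only the ends of a walk that is not closed can have this degree; the
   other degrees are at most [#|V|.-2]. *)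
have : \sum_v degree (walk_edges x p) v
       <= \sum_(v : V) (#|V|.-2 + ((v == x) + (v == last x p))).
  apply: leq_sum => v _; have := degree_le v uE; have := odd_degree_walk x p v.
  move: (degree _ v) (v == x) (v == _) (#|V|) eV V_gt0 => d [] [] n /=; lia.
have sum1 (y : V) : \sum_v (v == y) = 1.
  by rewrite (bigD1 y) //= eqxx big1 // => v /negbTE->.
rewrite sum_deg !big_split /= sum_const !sum1.
by move: (#|V|) (odd_double_half #|V|) eV le_c1 V_gt0 => n;
  rewrite uphalf_half; case: (odd n) => //=; nia.
Qed.

End TrailBound.

(** * Optimal trails by induction in steps of two *)

Definition nedge (u v : nat) := (minn u v, maxn u v).

Lemma nedgeC u v : nedge u v = nedge v u.
Proof. by rewrite /nedge minnC maxnC. Qed.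

(* The walk [a, v, b, v + 1, a, v + 2, b, ...], without its first vertex. *)
Fixpoint zigzag a b v n :=
  if n is n'.+1 then [:: v, b & zigzag b a v.+1 n'] else [::].

(** For odd [l] the zigzag ends at [l], and the extra [l.+1] crosses the edge between the two new
    vertices; for even [l] it ends at [l.+1] and that edge is left out. *)
Definition detour l :=
  [:: l, l & zigzag l l.+1 1 l.-1] ++ nseq (odd l) l.+1 ++ [:: l.+1; 0].

Lemma size_zigzag a b v n : size (zigzag a b v n) = n.*2.
Proof. by elim: n a b v => //= n IHn a b v; rewrite IHn. Qed.

Lemma last_zigzag a b v n : last a (zigzag a b v n) = if odd n then b else a.
Proof. by elim: n a b v => //= n IHn a b v; rewrite IHn; case: (odd n). Qed.

Lemma all_zigzag a b v n m :
  v + n <= m -> a < m -> b < m -> all (gtn m) (zigzag a b v n).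
Proof.
elim: n a b v => //= n IHn a b v le_m lt_a lt_b.
by rewrite IHn ?lt_b ?andbT //=; lia.
Qed.

(** The two edges at [v] do not recur because all later edges have a smaller end beyond [v]. *)
Lemma zigzag_edges a b v n m : v + n <= m -> m <= a -> m <= b -> a != b ->
  uniq (pairmap nedge a (zigzag a b v n)) &&
  all (fun e => [&& v <= e.1, e.1 < m & (e.2 == a) || (e.2 == b)])
    (pairmap nedge a (zigzag a b v n)).
Proof.
elim: n a b v => //= n IHn a b v le_m le_a le_b nab.
have /andP[uz /allP az] := IHn b a v.+1 ltac:(lia) le_b le_a ltac:(lia).
rewrite inE uz negb_or /= andbT.
have notin c : nedge v c \notin pairmap nedge b (zigzag b a v.+1 n) \/ c < m.
  have [?|le_c] := ltnP c m; first by right.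
  by left; apply/negP=> /az /=; lia.
apply/andP; split.
  rewrite (nedgeC a).
  have [->|] := notin a; last by lia.
  have [->|] := notin b; last by lia.
  by rewrite /nedge xpair_eqE; lia.
apply/and3P; split; [lia|lia|].
by apply/allP=> e /az /=; lia.
Qed.

(** The second conjunct says that each edge meets a new vertex; this separates the detour from any
    trail on the vertices below [l]. *)
Lemma detour_edges l : 0 < l ->
  uniq (pairmap nedge 0 (detour l)) &&
  all (fun e => l <= e.2) (pairmap nedge 0 (detour l)).
Proof.
move=> l_gt0; rewrite /detour /= pairmap_cat last_zigzag.
have /andP[uz /allP az] := @zigzag_edges l l.+1 1 l.-1 l ltac:(lia) ltac:(lia)
  ltac:(lia) ltac:(lia).
set z := pairmap _ _ _ in uz az *.
(* Zigzag edges have their smaller end between [1] and [l.-1]; for the other edges of the detour it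
   is [0] or at least [l]. *)
have z_notin u v : (minn u v == 0) || (l <= minn u v) -> nedge u v \notin z.
  by move=> uv; apply/negP=> /az /=; lia.
have az2 : all (fun e => l <= e.2) z by apply/allP=> -[u v] /az /=; lia.
have -> : odd l.-1 = ~~ odd l by case: (l) l_gt0 => //= n _; rewrite negbK.
case: (odd l); rewrite /= cat_uniq all_cat uz az2 /= !(inE, mem_cat) !negb_or;
  rewrite !z_notin /= ?xpair_eqE; do ?[apply/andP; split]; lia.
Qed.

Lemma max_trail_ex l : 0 < l -> exists p,
  [/\ all (gtn l) p, uniq (pairmap nedge 0 p) & size p = max_size l].
Proof.
have [n] := ubnP l; elim: n l => // n IHn [|[|[|l]]] //= lt_n _.
- by exists [:: 0].
- by exists [:: 0; 1; 1].
have [|//|p [all_p up size_p]] := IHn l.+1; first by lia.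
have /andP[ud /allP ad] := @detour_edges l.+1 isT.
exists (detour l.+1 ++ p); split.
- rewrite all_cat; apply/andP; split.
    rewrite /detour all_cat all_cat all_nseq /= all_zigzag; lia.
  by apply: sub_all all_p => i /=; lia.
- have last0 : last 0 (detour l.+1) = 0 by rewrite /detour !last_cat.
  rewrite pairmap_cat last0 cat_uniq ud up andbT /=.
  apply/hasPn=> e e_p; apply/negP=> /ad.
  suff /allP/(_ e e_p) : all (fun e => e.2 < l.+1) (pairmap nedge 0 p) by lia.
  (* This bound on the first vertex lets the induction on [p] generalize over that vertex. *)
  have: 0 < l.+1 by [].
  elim: p 0 {up size_p e_p} all_p => //= v p IHp u /andP[lt_v lt_p] lt_u.
  by rewrite IHp // andbT; lia.
rewrite size_cat size_p /detour !size_cat /= size_zigzag size_nseq.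
rewrite !max_sizeE //=; have := odd_double_half l.
by case: (odd l) => /=; nia.
Qed.

(** Passes from edges as sets to pairs of numbers, where walks on [l] and on [l + 2] vertices have a
    common type. *)
Lemma set2_nedge l (u v u' v' : 'I_l) :
  ([set u; v] == [set u'; v']) = (nedge u v == nedge u' v').
Proof.
have -> : (nedge u v == nedge u' v')
    = ((u == u') && (v == v')) || ((u == v') && (v == u')).
  by rewrite xpair_eqE -!val_eqE /=; lia.
apply/eqP/idP=> [/setP eq_e|/orP[]/andP[/eqP-> /eqP->]] //; last exact: setUC.
(* Testing membership of the four ends decides how they match. *)
have := eq_e u; have := eq_e v; have := eq_e u'; have := eq_e v'.
by rewrite !inE -!val_eqE /=; lia.
Qed.

Lemma path_complete l (x : 'I_l) p : path (add_loops (complete_graph l)) x p.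
Proof. by elim: p x => //= y p IHp x; rewrite IHp andbT; exact: orbN. Qed.

Lemma longest_trail_complete l : 0 < l ->
  longest_trail (add_loops (complete_graph l)) = max_size l.
Proof.
case: l => // l _; apply/eqP; rewrite eqn_leq; apply/andP; split.
  have [x [p [/andP[_ uE] <-]]] := longest_trail_ex (add_loops (complete_graph l.+1)) ord0.
  by rewrite -[in leqRHS](card_ord l.+1); apply: trail_size_max uE.
have [p [lt_p up <-]] := @max_trail_ex l.+1 isT.
have [q def_p] : exists q : seq 'I_l.+1, p = map val q.
  exists (map inord p); rewrite -map_comp -[LHS]map_id.
  by apply/eq_in_map=> i /(allP lt_p) /= lt_i; rewrite inordK.
rewrite def_p size_map; apply: (@trail_size_le _ _ ord0); apply/andP; split.
  exact: path_complete.
rewrite (eq_uniq_pairmap _ _ (@set2_nedge l.+1)) -(pairmap_map val nedge).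
by rewrite -def_p.
Qed.

(** * Snakes as trails *)

Lemma dom_subproof l (u v : 'I_l) :
  let p := if u <= v then (u, v) else (v, u) in p.1 <= p.2.
Proof. by case: ifP => /=; lia. Qed.

Definition dom l (u v : 'I_l) : domino l :=
  exist _ (if u <= v then (u, v) else (v, u)) (dom_subproof u v).

Definition place l (u v : 'I_l) : placed l := (dom u v, ~~ (u <= v)).

Lemma left_end_place l (u v : 'I_l) : left_end (place u v) = u.
Proof. by rewrite /left_end /=; case: leqP. Qed.

Lemma right_end_place l (u v : 'I_l) : right_end (place u v) = v.
Proof. by rewrite /right_end /=; case: leqP. Qed.

Lemma dom_ends l (d : placed l) : dom (left_end d) (right_end d) = d.1.
Proof.
apply: val_inj; case: d => [[[u v] /= le_uv] []]; rewrite /left_end /right_end /=.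
  case: ifP => // le_vu; have -> // : u = v by apply/val_inj => /=; lia.
by rewrite le_uv.
Qed.

Lemma set2_dom l (u v u' v' : 'I_l) :
  ([set u; v] == [set u'; v']) = (dom u v == dom u' v').
Proof.
rewrite set2_nedge -val_eqE /= !xpair_eqE.
by case: ifP; case: ifP; rewrite !xpair_eqE -!val_eqE /=; lia.
Qed.

(** Consecutive edges of a walk share a vertex, so touching ends agree by construction, and distinct
    edges are distinct dominoes. *)
Lemma snake_place l (x : 'I_l) p :
  trail (add_loops (complete_graph l)) x p = snake (pairmap (@place l) x p).
Proof.
rewrite /trail /snake; congr (_ && _).
  rewrite (_ : path _ _ _ = true).
    case: p => //= y p; elim: p x y => //= z p IHp x y.
    by rewrite -IHp right_end_place left_end_place eqxx.
  exact: path_complete.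
have -> : [seq d.1 | d <- pairmap (@place l) x p] = pairmap (@dom l) x p.
  by elim: p x => //= y p IHp x; rewrite IHp.
exact/eq_uniq_pairmap/set2_dom.
Qed.

(** The walk runs from the left end of the first domino through all right ends; [x0] serves the
    empty snake. *)
Lemma snake_trail_ex l (x0 : 'I_l) (s : seq (placed l)) : snake s ->
  exists x p, trail (add_loops (complete_graph l)) x p /\ size p = size s.
Proof.
case: s => [|d s]; first by exists x0, [::].
case/andP=> /= path_s uniq_s; exists (left_end d), (map (@right_end l) (d :: s)).
split; last exact: size_map.
rewrite /trail path_complete (eq_uniq_pairmap _ _ (@set2_dom l)) /= dom_ends.
suff -> : pairmap (@dom l) (right_end d) (map (@right_end l) s)
          = [seq e.1 | e <- s] by [].
elim: s d path_s {uniq_s} => //= e s IHs d /andP[/eqP-> path_s].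
by rewrite dom_ends IHs.
Qed.

Lemma longest_snake_trail l : 0 < l ->
  longest_snake l = longest_trail (add_loops (complete_graph l)).
Proof.
case: l => // l _; apply/eqP; rewrite eqn_leq; apply/andP; split.
  have [s /(snake_trail_ex ord0)[x [p [tr_p <-]]] <-] := longest_snake_ex l.+1.
  exact: trail_size_le tr_p.
have [x [p [tr <-]]] := longest_trail_ex (add_loops (complete_graph l.+1)) ord0.
by rewrite -(size_pairmap (@place l.+1) x) snake_size_le // -snake_place.
Qed.

(** * Right lane lengths *)

Lemma foldl_park_ones a b n : a <= b ->
  foldl park (a, b) (nseq n true)
    = (a + b + n - maxn b (uphalf (a + b + n)), maxn b (uphalf (a + b + n))).
Proof.
(* Ones fill the left lane until it has caught up, then the lanes alternate, right first; [a <= b]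
   is preserved throughout. *)
elim: n a b => [|n IHn] a b le_ab /=; first by congr pair; lia.
by case: ifP => [lt_ab|ge_ab]; rewrite IHn; try lia; congr pair; lia.
Qed.

Definition one_zero l (i : 'I_l) : l.-tuple bool := [tuple j != i | j < l].

Lemma one_zeroE l (i : 'I_l) :
  one_zero i = nseq i true ++ false :: nseq (l - i.+1) true :> seq bool.
Proof.
(* With [true] as default, a lookup in the block of ones after the zero gives [true] at every
   index. *)
have lt_il := ltn_ord i; apply: (@eq_from_nth _ true) => [|j].
  by rewrite size_tuple size_cat /= !size_nseq; lia.
rewrite size_tuple => lt_j; rewrite -[j]/(val (Ordinal lt_j)) -tnth_nth.
rewrite tnth_mktuple nth_cat size_nseq /= -val_eqE /=.
case: ltngtP => [lt_ji|lt_ij|->]; rewrite ?subnn // ?nth_nseq ?lt_ji //.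
by case: (j - i) (subn_gt0 i j) => [|k _] /=; rewrite ?lt_ij ?nth_nseq ?if_same.
Qed.

Lemma arrivals1 l : arrivals l 1 = [set one_zero i | i : 'I_l].
Proof.
apply/setP=> b; rewrite inE; apply/eqP/imsetP=> [|[i _ ->]]; last first.
  by rewrite one_zeroE count_cat /= !count_nseq.
rewrite -[in count_mem _ _]map_tnth_enum count_map.
have -> : count (preim (tnth b) (pred1 false)) (enum 'I_l)
          = #|[pred j | tnth b j == false]|.
  by rewrite cardE enumT -size_filter /enum_mem.
move/mem_card1=> [i b_i]; exists i => //; apply/eq_from_tnth => j.
have := b_i j; rewrite tnth_mktuple !inE /=.
by case: (tnth b j) => /= <-.
Qed.

(** Just after the zero the right lane has [uphalf i.+2] cars, which exceeds [uphalf l] only if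
    [i.+1] equals [l] and [l] is even; otherwise the later ones bring it to [uphalf l]. *)
Lemma right_lane_one_zero l (i : 'I_l) :
  right_lane (one_zero i) = uphalf l + (~~ odd l && (i.+1 == l)).
Proof.
have lt_il := ltn_ord i; rewrite /right_lane one_zeroE foldl_cat /=.
rewrite foldl_park_ones //= foldl_park_ones /=; lia.
Qed.

Lemma right_total1 l : 0 < l -> right_total l 1 = max_size l.
Proof.
move=> l_gt0; rewrite /right_total arrivals1 big_imset /=; last first.
  move=> i j _ _ /(congr1 (fun t => tnth t i)); rewrite !tnth_mktuple eqxx.
  by move/esym/negbFE/eqP.
under eq_bigr do rewrite right_lane_one_zero.
rewrite big_split /= sum_nat_const card_ord max_sizeE //; congr (_ + _).
case: (odd l); first by rewrite big1.
(* Only the zero in the last position yields the extra car. *)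
have lt_l : l.-1 < l by lia.
rewrite (bigD1 (Ordinal lt_l)) //= big1 => [|i]; first by lia.
by rewrite -val_eqE /=; lia.
Qed.

Theorem theorem5p2 (l : nat) (hl : 1 <= l) :
  [/\ right_total l 1 = longest_snake l,
      longest_snake l = longest_trail (add_loops (complete_graph l))
    & longest_trail (add_loops (complete_graph l)) =
        if odd l then 'C(l, 2) + l else 'C(l, 2) + l %/ 2 + 1].
Proof.
have trailE := longest_trail_complete hl.
by split; rewrite ?longest_snake_trail ?right_total1.
Qed.
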